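(* Let $k\ge2$ and fix an index $j_0\in\{2,\dots,k\}$. There is a deterministic one-way number-on-the-forehead protocol of communication cost $O(n\log^{(k-1)}n)$, in which every player is collapsing, that computes $\widehat{\textsc{mpj}}_k(i,f_2,\ldots,f_k)$ on all inputs in which $f_j$ is a permutation of $[n]$ for every $j\ne j_0$ (while $f_{j_0}\in[n]^{[n]}$ is arbitrary). In particular there is such a protocol for $\widehat{\textsc{mpj}}^{\rm perm}_k$.
   Context: Logarithms are base $2$ and $\log^{(m)}n$ is the $m$-times iterated logarithm; $[n]=\{1,\dots,n\}$. $\widehat{\textsc{mpj}}_k:[n]\times([n]^{[n]})^{k-1}\to[n]$ is given by $\widehat{\textsc{mpj}}_k(i,f_2,\ldots,f_k)=f_k\circ\cdots\circ f_2(i)$; $\widehat{\textsc{mpj}}^{\rm perm}_k$ is its restriction to inputs where all of $f_2,\dots,f_k$ are permutations of $[n]$. Write the input as $(z_1,\dots,z_k)$ with $z_1=i$, $z_j=f_j$ ($j\ge2$). In the number-on-the-forehead model $z_j$ is on player $j$'s forehead and she sees all $z_h$, $h\ne j$. In a deterministic one-way protocol, players $1,\dots,k$ each write one message on a public blackboard in this order, each a deterministic function of what she sees and earlier messages; player $k$'s message must equal the function value; cost is the worst-case total number of bits. Player $j$ is collapsing if her message depends only on the previous messages, on $z_1,\dots,z_{j-1}$, and on the function $g_j(w_1,\dots,w_j)=\widehat{\textsc{mpj}}_k(w_1,\dots,w_j,z_{j+1},\dots,z_k)$; concretely, only on the previous messages, $i,f_2,\dots,f_{j-1}$ and the composition $f_k\circ\cdots\circ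 f_{j+1}$. *)

(* Defs.v *)
From HB Require Import structures.
From mathcomp Require Import all_boot all_order all_algebra.
From mathcomp Require Import all_classical all_reals all_analysis.

Set Implicit Arguments.
Unset Strict Implicit.
Unset Printing Implicit Defensive.

Import Order.TTheory GRing.Theory Num.Theory.
Import numFieldNormedType.Exports.

Local Open Scope classical_set_scope.
Local Open Scope nat_scope.

(* Players, and the parts z_1, ..., z_k of the input, are numbered from 1.
   The set [n] is 'I_n.  An input is a pair (i, f), with z_1 = i, and
   z_(t+2) = f t for t : 'I_k.-1, so that f stands for (f_2, ..., f_k). *)
Definition input (n k : nat) : finType :=
  ('I_n * {ffun 'I_k.-1 -> {ffun 'I_n -> 'I_n}})%type.

Definition mpj n k (x : input n k) : 'I_n :=
  foldl (fun a t => x.2 t a) x.1 (enum 'I_k.-1).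

(* x and y have the same z_h for every h satisfying S. *)
Definition agree_on n k (S : pred nat) (x y : input n k) : Prop :=
  (S 1 -> x.1 = y.1) /\ (forall t : 'I_k.-1, S t.+2 -> x.2 t = y.2 t).

(* (w_1, ..., w_j, z_(j+1), ..., z_k), for 1 <= j. *)
Definition splice n k (j : nat) (w z : input n k) : input n k :=
  (w.1, [ffun t : 'I_k.-1 => if t.+2 <= j then w.2 t else z.2 t]).

(* The function g_j of the input z. The argument w ranges over whole inputs,
   but only w_1, ..., w_j are used. *)
Definition residual n k (j : nat) (z w : input n k) : 'I_n := mpj (splice j w z).

(* The composition f_k \o ... \o f_(j+1). *)
Definition tail_comp n k (j : nat) (z : input n k) (a : 'I_n) : 'I_n :=
  foldl (fun b t => z.2 t b) a [seq t : 'I_k.-1 <- enum 'I_k.-1 | j < t.+2].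

(* [msg j x h] is what player j writes on input x when the earlier messages
   are h; it is only relevant for 1 <= j <= k. *)
Record protocol (n k : nat) := Protocol {
  msg : nat -> input n k -> seq (seq bool) -> seq bool;
  msg_forehead : forall (j : nat) (x y : input n k) (h : seq (seq bool)),
    1 <= j <= k -> agree_on (fun m => m != j) x y -> msg j x h = msg j y h
}.

Definition collapsing_player n k (P : protocol n k) (j : nat) : Prop :=
  forall (x y : input n k) (h : seq (seq bool)),
    agree_on (fun m => m < j) x y -> residual j x =1 residual j y ->
    msg P j x h = msg P j y h.

Definition collapsing n k (P : protocol n k) : Prop :=
  forall j : nat, 1 <= j <= k -> collapsing_player P j.

Definition transcript n k (P : protocol n k) (x : input n k) : seq (seq bool) :=
  foldl (fun h j => rcons h (msg P j x h)) [::] (iota 1 k).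

(* The maximum is over all inputs, not only those on which the protocol is
   required to be correct. *)
Definition cost n k (P : protocol n k) : nat :=
  \max_(x : input n k) sumn [seq size m | m <- transcript P x].

(* Binary expansion on ceil (log_2 n) bits, least significant bit first. *)
Definition encode n (a : 'I_n) : seq bool :=
  mkseq (fun b => odd (a %/ 2 ^ b)) (up_log 2 n).

Definition computes_on n k (P : protocol n k) (D : input n k -> Prop) : Prop :=
  forall x : input n k, D x -> last [::] (transcript P x) = encode (mpj x).

Definition perm_except n k (j0 : nat) (x : input n k) : Prop :=
  forall t : 'I_k.-1, t.+2 != j0 -> bijective (x.2 t).

Definition all_perm n k (x : input n k) : Prop :=
  forall t : 'I_k.-1, bijective (x.2 t).

Definition log2 (R : realType) (x : R) : R := (ln x / ln 2)%R.

Definition iterlog (R : realType) (m n : nat) : R := iter m (@log2 R) n%:R%R.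

(* Landau's O is for n tending to infinity, so the values of iterlog on the
   finitely many n where the iterated logarithm is undefined or nonpositive
   play no role. *)
Definition has_collapsing_protocols (R : realType) (k : nat)
    (D : forall n : nat, input n k -> Prop) : Prop :=
  exists P : forall n : nat, protocol n k,
    [/\ forall n : nat, collapsing (P n),
        forall n : nat, computes_on (P n) (D n)
      & ((fun n : nat => (cost (P n))%:R : R^o) =O_\oo
         (fun n : nat => n%:R * iterlog R k.-1 n : R^o))%R].

Lemma encode_inj n : injective (@encode n).
Proof.
have bits w : forall a b : nat, a < 2 ^ w -> b < 2 ^ w ->
    (forall c, c < w -> odd (a %/ 2 ^ c) = odd (b %/ 2 ^ c)) -> a = b.
  elim: w => [|w IHw] a b; first by rewrite !ltnS !leqn0 => /eqP-> /eqP->.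
  move=> ha hb hab.
  have h0 : odd a = odd b by have := hab 0 isT; rewrite expn0 !divn1.
  rewrite -(odd_double_half a) -(odd_double_half b) h0; congr (_ + _.*2).
  apply: IHw => [||c hc]; rewrite -?divn2 ?ltn_divLR -?expnSr //.
  by rewrite -!divnMA -!expnS; apply: hab.
move=> a b eq_ab; apply: val_inj; apply: (bits (up_log 2 n)) => [||c hc].
- by apply: leq_trans (ltn_ord a) _; exact: up_logP.
- by apply: leq_trans (ltn_ord b) _; exact: up_logP.
- by have := congr1 (fun s => nth false s c) eq_ab; rewrite !nth_mkseq.
Qed.

Lemma residual_tail_comp n k (j : nat) (x y : input n k) : 1 <= j ->
  residual j x =1 residual j y <-> tail_comp j x =1 tail_comp j y.
Proof.
move=> j_gt0.
have foldE (w z : input n k) (s : seq 'I_k.-1) (a : 'I_n) :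
    sorted ltn (map val s) ->
    foldl (fun b t => (splice j w z).2 t b) a s =
    foldl (fun b t => z.2 t b)
      (foldl (fun b t => w.2 t b) a [seq t : 'I_k.-1 <- s | t.+2 <= j])
      [seq t : 'I_k.-1 <- s | j < t.+2].
  elim: s a => [//|t s IHs] a /=.
  rewrite (path_sortedE ltn_trans).
  case/andP=> hall hs; rewrite ffunE.
  case: (leqP t.+2 j) => [le_tj|gt_tj] /=; rewrite IHs //.
  have -> // : [seq t0 : 'I_k.-1 <- s | t0.+2 <= j] = [::].
  apply/eqP; rewrite -[_ == _]negbK -has_filter; apply/hasPn => u us.
  have /allP/(_ (val u)) := hall; rewrite map_f // => /(_ isT) lt_tu.
  by rewrite -ltnNge; apply: leq_trans gt_tj _; rewrite !ltnS ltnW.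
have enumS : sorted ltn (map val (enum 'I_k.-1)).
  by rewrite val_enum_ord iota_ltn_sorted.
have residualE (w z : input n k) : residual j z w =
    tail_comp j z (foldl (fun b t => w.2 t b) w.1
                     [seq t : 'I_k.-1 <- enum 'I_k.-1 | t.+2 <= j]).
  exact: (foldE w z _ w.1 enumS).
split=> [eq_g a|eq_t w]; last by rewrite !residualE eq_t.
pose e : input n k := (a, [ffun=> [ffun b => b]]).
have foldid (s : seq 'I_k.-1) : foldl (fun b t => e.2 t b) a s = a.
  by elim: s => //= t s IHs; rewrite !ffunE.
by have := eq_g e; rewrite !residualE foldid.
Qed.

(* Main.v *)
(* Write F_j for f_k \o ... \o f_(j+1) and p_j for f_j \o ... \o f_2 (i), so
   that the answer is F_j p_j for every j.  Player j + 1 learns from player j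
   in which of about B_j buckets the answer lies, hence that p_(j+1) lies in
   the preimage S of that bucket under F_(j+1).  For every a in S she then
   writes the bucket of F_(j+1) a in a finer partition, with B_(j+1) about
   2 ^ B_j; player j + 2, who knows p_(j+1), reads off the relevant entry.

   The buckets are consecutive intervals of answers holding about n / B_j
   points of the domain each.  An answer with a larger fiber is alone of its
   kind in its bucket; it is excluded from S and transmitted explicitly, as
   the answer to assume when p_(j+1) is not in S.

   Players j and j + 1 must agree on the partition, which depends only on the
   fiber sizes of F_(j+1).  If j + 1 < j0, then F_j = F_(j+1) \o f_(j+1) has the
   same fiber sizes since f_(j+1) is a permutation.  If j0 <= j + 1, then
   F_(j+1) is a permutation, and all its fibers are singletons. *)

Require Import Defs.
From mathcomp Require Import all_boot all_order all_algebra.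
From mathcomp Require Import all_classical all_reals all_analysis.
From mathcomp Require Import lra zify.

Set Implicit Arguments.
Unset Strict Implicit.
Unset Printing Implicit Defensive.

Import Order.TTheory GRing.Theory Num.Theory.

(** * Prefix-free encoding of tables of bucket names *)

Definition letter B (o : option 'I_B) : seq bool :=
  if o is Some b then true :: encode b else [:: false].

Definition code n B (g : {ffun 'I_n -> option 'I_B}) : seq bool :=
  flatten [seq letter (g a) | a <- enum 'I_n].

Lemma size_letter B (o : option 'I_B) : size (letter o) = 1 + o * up_log 2 B.
Proof. by case: o => [b|]; rewrite /= ?size_mkseq ?mul1n. Qed.

Lemma letter_cat_inj B (o o' : option 'I_B) s s' :
  letter o ++ s = letter o' ++ s' -> o = o' /\ s = s'.
Proof.
case: o o' => [b|] [b'|] //= [] => [/eqP|->] //.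
by rewrite eqseq_cat ?size_mkseq // => /andP[/eqP/encode_inj-> /eqP->].
Qed.

(** The flag bit and the fixed width of names make letters prefix-free, and a table has exactly [n]
    of them; so it can be cut off the front of a message without a length marker. *)
Lemma code_cat_inj n B (g g' : {ffun 'I_n -> option 'I_B}) s s' :
  code g ++ s = code g' ++ s' -> g = g' /\ s = s'.
Proof.
suff inj e : flatten [seq letter (g a) | a <- e] ++ s =
             flatten [seq letter (g' a) | a <- e] ++ s' ->
             {in e, g =1 g'} /\ s = s'.
  by case/inj => eq_g ->; split=> //; apply/ffunP => a; apply: eq_g; rewrite mem_enum.
elim: e => [|a e IHe] //=; rewrite -!catA => /letter_cat_inj[eq_ga /IHe[eq_g ->]].
by split=> // b; rewrite inE => /predU1P[->|/eq_g].
Qed.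

Lemma size_code n B (g : {ffun 'I_n -> option 'I_B}) :
  size (code g) = n + #|[set a | g a]| * up_log 2 B.
Proof.
rewrite size_flatten sumnE 2!big_map big_enum /=.
under eq_bigr do rewrite size_letter.
rewrite big_split /= sum1_card card_ord -big_distrl /= -sum1_card.
by rewrite [in RHS]big_mkcond /=; congr (_ + _ * _); apply: eq_bigr => a _;
  rewrite inE; case: (g a).
Qed.

(* Messages have the form [code g ++ s]; reading one at [a] yields the
   letter [g a], or [s] if there is none. *)
Definition read n B (m : seq bool) (a : 'I_n) : seq bool + nat :=
  if [pick g : {ffun 'I_n -> option 'I_B} | prefix (code g) m] is Some g then
    if g a is Some b then inr (val b) else inl (drop (size (code g)) m)
  else inr 0.

Lemma read_code n B (g : {ffun 'I_n -> option 'I_B}) s a :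
  read B (code g ++ s) a = if g a is Some b then inr (val b) else inl s.
Proof.
rewrite /read; case: pickP => [g' /prefixP[s' eq_gs]|/(_ g)]; last first.
  by rewrite prefix_prefix.
by have [-> _] := code_cat_inj eq_gs; rewrite drop_size_cat.
Qed.

(** * Buckets of answers, light points and heavy answers *)

Section Buckets.
Variable n : nat.
Implicit Types (F G : {ffun 'I_n -> 'I_n}) (y a : 'I_n).

Definition below F y := #|[set a | F a < y]|.
Definition fiber F y := #|[set a | F a == y]|.
(** With the domain sorted by [F], [below F y] is the rank where the fiber of [y] starts; a bucket
    collects the answers whose fibers start in the same block of [T] ranks. *)
Definition bucket T F y := below F y %/ T.
Definition light T F q :=
  [set a | (bucket T F (F a) == q) && (fiber F (F a) < T)].

Definition heavy_answer T F q : seq bool :=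
  if [pick y | (bucket T F y == q) && (T <= fiber F y)] is Some y
  then encode y else [::].

Lemma below_fiber F y : below F y + fiber F y = #|[set a | F a <= y]|.
Proof.
rewrite /below /fiber -cardsUI addnC.
rewrite (_ : _ :&: _ = finset.set0); last first.
  by apply/setP => a; rewrite !inE -val_eqE /=; case: ltngtP.
rewrite cards0; congr #|pred_of_set _|.
by apply/setP => a; rewrite !inE -val_eqE /=; case: ltngtP.
Qed.

Lemma bucket_lt T F y : bucket T F y < (n %/ T).+1.
Proof. by rewrite ltnS leq_div2r // -[leqRHS]card_ord max_card. Qed.

Lemma bucket_comp T F G (s : {ffun 'I_n -> 'I_n}) : injective s ->
  (forall a, F a = G (s a)) -> bucket T F =1 bucket T G.
Proof.
move=> inj_s FE y; congr (_ %/ _); rewrite /below -[RHS](card_preimset _ inj_s).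
by apply: eq_card => a; rewrite !inE FE.
Qed.

(** A fiber of at least [T] points pushes the start of every larger answer into a later block of
    ranks. *)
Lemma heavy_inj T F y y' : 0 < T -> T <= fiber F y -> T <= fiber F y' ->
  bucket T F y = bucket T F y' -> y = y'.
Proof.
move=> T_gt0; wlog le_yy' : y y' / y <= y'.
  by move=> H; case/orP: (leq_total y y') => /H{}H Ty Ty' eq_b; [|apply/esym]; apply: H.
move=> Ty _ eq_b; apply/val_inj/eqP; rewrite eqn_leq le_yy' leqNgt /=.
apply/negP => lt_yy'; have : bucket T F y < bucket T F y'.
  rewrite /bucket leq_divRL // mulSn addnC.
  apply: leq_trans (_ : below F y + fiber F y <= _).
    by rewrite leq_add // leq_trunc_div.
  rewrite below_fiber; apply/subset_leq_card/fintype.subsetP => a; rewrite !inE.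
  by move/leq_ltn_trans; apply.
by rewrite eq_b ltnn.
Qed.

Lemma heavy_answerE T F y : 0 < T -> T <= fiber F y ->
  heavy_answer T F (bucket T F y) = encode y.
Proof.
move=> T_gt0 Ty; rewrite /heavy_answer; case: pickP => [z /andP[/eqP eq_b Tz]|].
  by rewrite (heavy_inj T_gt0 Tz Ty eq_b).
by move/(_ y); rewrite eqxx Ty.
Qed.

Lemma size_heavy_answer T F q : size (heavy_answer T F q) <= up_log 2 n.
Proof. by rewrite /heavy_answer; case: pickP => // y _; rewrite size_mkseq. Qed.

(** The light points lie between the start of the least light answer in the bucket and the end of
    the greatest. Both starts are in one block of [T] ranks, and the last fiber has fewer than [T]
    points. *)
Lemma card_light T F q : 0 < T -> #|light T F q| <= 2 * T.
Proof.
move=> T_gt0; have [->|[a0 a0q]] := set_0Vmem (light T F q); first by rewrite cards0.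
have [a1 a1q max_a1] := arg_maxnP (fun a => F a : nat) a0q.
have [a2 a2q min_a2] := arg_minnP (fun a => F a : nat) a0q.
have {}max_a1 a : a \in light T F q -> F a <= F a1 by exact: max_a1.
have {}min_a2 a : a \in light T F q -> F a2 <= F a by exact: min_a2.
have : #|light T F q| + below F (F a2) <= below F (F a1) + fiber F (F a1).
  rewrite below_fiber -cardsUI (_ : _ :&: _ = finset.set0); last first.
    apply/setP => a; rewrite finset.in_setI finset.in_set0; apply/negP.
    by case/andP => /min_a2; rewrite inE leqNgt => /negP.
  rewrite cards0 addn0; apply/subset_leq_card/fintype.subsetP => a.
  case/finset.setUP => [/max_a1|]; rewrite !inE // => /ltnW le_a.
  by apply: leq_trans le_a _; apply: max_a1.
have {a1q}: a1 \in light T F q by [].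
have {a2q}: a2 \in light T F q by [].
rewrite !inE /bucket => /andP[/eqP q2 _] /andP[/eqP q1 h1].
have := divn_eq (below F (F a1)) T; have := divn_eq (below F (F a2)) T.
have := ltn_pmod (below F (F a1)) T_gt0; rewrite q1 q2; lia.
Qed.

End Buckets.

(** * Partial compositions p_j and tail compositions F_j *)

Definition position n k j (x : input n k) : 'I_n :=
  foldl (fun b t => x.2 t b) x.1 (take j.-1 (enum 'I_k.-1)).

Definition residual_map n k j (x : input n k) : {ffun 'I_n -> 'I_n} :=
  [ffun a => tail_comp j x a].

Lemma tail_compE n k j (x : input n k) a : 0 < j ->
  tail_comp j x a = foldl (fun b t => x.2 t b) a (drop j.-1 (enum 'I_k.-1)).
Proof.
case: j => // j _; rewrite /tail_comp /=; congr foldl.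
apply: (inj_map val_inj); rewrite map_drop.
rewrite (eq_filter (a2 := preim val (fun t => 0 + j <= t))); last first.
  by move=> t; rewrite /= add0n !ltnS.
rewrite -filter_map val_enum_ord.
elim: {k x}k.-1 0 j => [|m IHm] i [|j] //=.
  by rewrite addn0 leqnn (all_filterP _) //; apply/allP => t; rewrite mem_iota => /andP[/ltnW].
by rewrite addnS ltnNge leq_addr /= -addSn IHm.
Qed.

Lemma tail_comp_id n k j (x : input n k) a : 0 < k <= j -> tail_comp j x a = a.
Proof.
case/andP=> k_gt0 le_kj; rewrite tail_compE ?drop_oversize //; last by lia.
by rewrite size_enum_ord; lia.
Qed.

Lemma tail_comp_position n k j (x : input n k) : 0 < j ->
  tail_comp j x (position j x) = mpj x.
Proof. by move=> j_gt0; rewrite tail_compE // -foldl_cat cat_take_drop. Qed.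

Lemma tail_comp_step n k j (x : input n k) : 0 < j < k ->
  exists2 t : 'I_k.-1, t.+2 = j.+1 &
    forall a, tail_comp j x a = tail_comp j.+1 x (x.2 t a).
Proof.
case/andP=> j_gt0 lt_jk; have lt_j : j.-1 < k.-1 by lia.
exists (Ordinal lt_j) => [|a] /=; first by lia.
rewrite !tail_compE // (drop_nth (Ordinal lt_j)) ?size_enum_ord //=.
by rewrite prednK // (nth_ord_enum _ (Ordinal lt_j)).
Qed.

Lemma tail_comp_inj n k j j0 (x : input n k) : 0 < j0 <= j ->
  perm_except j0 x -> injective (tail_comp j x).
Proof.
case/andP=> j0_gt0 le_j0j x_perm a b; rewrite /tail_comp.
have : all (fun t : 'I_k.-1 => j < t.+2) [seq t : 'I_k.-1 <- enum 'I_k.-1 | j < t.+2].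
  exact: filter_all.
elim: [seq _ <- _ | _] a b => //= t s IHs a b /andP[lt_j s_gt] /IHs-/(_ s_gt).
by apply: bij_inj; apply: x_perm; lia.
Qed.

(** * The bucket protocol: locality, correctness and cost *)

Section Protocol.
(* [T j] bounds the number of candidates in play after the message of player [j]. *)
Variables (n k j0 : nat) (T : nat -> nat).
Implicit Types (x : input n k) (F : {ffun 'I_n -> 'I_n}) (r : seq bool + nat).

(* Player [j] must name a bucket of the answer for the residual map of player
   [j.+1].  That map differs from this one by a permutation: [f_(j+1)] if
   [j.+1 < j0], and otherwise the residual map of player [j.+1] itself. *)
Definition next_map j F : {ffun 'I_n -> 'I_n} :=
  if j.+1 < j0 then F else [ffun a => a].

Definition refine j F q : {ffun 'I_n -> option 'I_(n %/ T j).+1} :=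
  [ffun a => if a \in light (T j.-1) F q
             then Some (inord (bucket (T j) (next_map j F) (F a))) else None].

(** A player who received the answer forwards it beside an empty table. The truncation keeps the
    message short even if [s] encodes no answer, since [cost] ranges over all inputs. *)
Definition reply j F r : {ffun 'I_n -> option 'I_(n %/ T j).+1} * seq bool :=
  match r with
  | inl s => ([ffun=> None], take (up_log 2 n) s)
  | inr q => (refine j F q, heavy_answer (T j.-1) F q)
  end.

Definition received j x h : seq bool + nat :=
  if j <= 1 then inr 0
  else read (n %/ T j.-1).+1 (last [::] h) (position j.-1 x).

(** For [j = k] the table is dropped, as the last message must be the bare encoding of the
    answer. *)
Definition bucket_msg j x (h : seq (seq bool)) : seq bool :=
  let: (g, s) := reply j (residual_map j x) (received j x h) in
  if j < k then code g ++ s else s.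

(** The message is read at p_(j-1), which involves only parts before [j], and everything else
    depends on F_j. Both the forehead rule and the collapsing property follow. *)
Lemma bucket_msg_local j x y h : agree_on (fun m => m < j) x y ->
  tail_comp j x =1 tail_comp j y -> bucket_msg j x h = bucket_msg j y h.
Proof.
case=> eq1 eq2 eq_t; rewrite /bucket_msg.
have -> : residual_map j x = residual_map j y by apply/ffunP => a; rewrite !ffunE.
suff -> : received j x h = received j y h by [].
rewrite /received; case: leqP => // j_gt1; congr read.
rewrite /position eq1 //.
have : all (fun t : 'I_k.-1 => t.+2 < j) (take j.-1.-1 (enum 'I_k.-1)).
  apply/allP => t /(map_f val); rewrite map_take val_enum_ord take_iota mem_iota /=.
  by lia.
elim: (take _ _) (y.1) => //= t s IHs a /andP[lt_t /IHs].
by rewrite eq2.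
Qed.

Lemma bucket_msg_forehead j x y h : 1 <= j <= k ->
  agree_on (fun m => m != j) x y -> bucket_msg j x h = bucket_msg j y h.
Proof.
move=> jk [eq1 eq2]; apply: bucket_msg_local.
  by split=> [lt_j|t lt_j]; [apply: eq1|apply: eq2]; lia.
move=> a; rewrite /tail_comp.
have : all (fun t : 'I_k.-1 => j < t.+2) [seq t : 'I_k.-1 <- enum 'I_k.-1 | j < t.+2].
  exact: filter_all.
elim: [seq _ <- _ | _] a => //= t s IHs a /andP[lt_j /IHs].
by rewrite eq2 //; lia.
Qed.

Definition bucket_protocol : protocol n k := Protocol bucket_msg_forehead.

Lemma bucket_protocol_collapsing : collapsing bucket_protocol.
Proof.
move=> j /andP[j_gt0 _] x y h eq_x /(residual_tail_comp _ _ j_gt0).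
exact: bucket_msg_local.
Qed.

Definition history j x : seq (seq bool) :=
  foldl (fun h i => rcons h (bucket_msg i x h)) [::] (iota 1 j).

Lemma historyS j x :
  history j.+1 x = rcons (history j x) (bucket_msg j.+1 x (history j x)).
Proof. by rewrite /history -(addn1 j) iotaD foldl_cat addn1. Qed.

Hypotheses (T_gt0 : forall j, 0 < T j) (T0 : T 0 = n.+1) (Tlast : T k.-1 = 1).
Hypotheses (k_gt1 : 1 < k) (j0_gt0 : 0 < j0).

Lemma bucket_next j x : 0 < j < k -> perm_except j0 x ->
  bucket (T j) (next_map j (residual_map j x)) =1 bucket (T j) (residual_map j.+1 x).
Proof.
move=> jk x_perm; rewrite /next_map; case: leqP => [le_j0|lt_j0]; last first.
  have [t tE tail_jE] := tail_comp_step x jk.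
  apply: (@bucket_comp _ _ _ _ (x.2 t)) => [|b]; last by rewrite !ffunE.
  by apply/bij_inj/x_perm; lia.
(* Here F_(j+1) is a permutation, hence the identity precomposed with a permutation. *)
move=> y; apply/esym/(@bucket_comp _ _ _ _ (residual_map j.+1 x)) => [|b].
  move=> b b'; rewrite !ffunE; apply: (@tail_comp_inj _ _ _ j0) => //; lia.
by rewrite !ffunE.
Qed.

Lemma fiber_residual_id x y : fiber (residual_map k x) y = 1.
Proof.
rewrite /fiber -(cards1 y); apply: eq_card => a.
by rewrite !inE ffunE tail_comp_id ?leqnn // ltnW.
Qed.

(** The invariant of a run: each player receives either the answer itself or its bucket. *)
Definition good j x r : Prop :=
  r = inl (encode (mpj x)) \/
  r = inr (bucket (T j.-1) (residual_map j x) (mpj x)).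

Lemma received_good j x : 0 < j <= k -> perm_except j0 x ->
  good j x (received j x (history j.-1 x)).
Proof.
move=> jk x_perm; elim: j jk => // [[|j]] IHj jk.
  (* Bucket 0 is right for player 1, because every rank is below [T 0 = n.+1]. *)
  right; rewrite /received /= T0; congr inr; apply/esym/divn_small.
  by rewrite ltnS -[leqRHS]card_ord max_card.
have jk' : 0 < j.+1 < k by lia.
have {IHj}r_good : good j.+1 x (received j.+1 x (history j x)) by apply: IHj; lia.
rewrite /received /= historyS last_rcons /bucket_msg.
move: (received _ _ _) r_good => r r_good.
have -> : j.+1 < k by lia.
have rE := tail_comp_position x (ltn0Sn j).
case: r_good => -> /=; rewrite read_code ffunE.
  by left; rewrite take_oversize // size_mkseq.
(* F_(j+1) sends p_(j+1) to the answer, so there is a letter at p_(j+1) exactly when the fiber of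
   the answer is small. *)
have -> : (position j.+1 x \in light (T j) (residual_map j.+1 x)
    (bucket (T j) (residual_map j.+1 x) (mpj x))) =
  (fiber (residual_map j.+1 x) (mpj x) < T j) by rewrite inE ffunE rE eqxx.
case: ltnP => [_|heavy]; last by left; rewrite heavy_answerE.
right; rewrite /= inordK ?bucket_lt // ffunE rE bucket_next //.
Qed.

Lemma bucket_protocol_computes : computes_on bucket_protocol (@perm_except n k j0).
Proof.
move=> x x_perm; rewrite /transcript -[foldl _ _ _]/(history k x).
have k_gt0 := ltnW k_gt1.
have := historyS k.-1 x; rewrite prednK // => ->; rewrite last_rcons.
have kk : 0 < k <= k by rewrite k_gt0 leqnn.
rewrite /bucket_msg ltnn; case: (received_good kk x_perm) => -> /=.
  by rewrite take_oversize // size_mkseq.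
(* F_k is the identity and the last threshold is 1, so every answer is heavy and gets written
   explicitly. *)
by rewrite heavy_answerE // fiber_residual_id Tlast.
Qed.

(** One flag per domain point, a bucket name per light point, and one explicit answer. *)
Definition msg_bound j := n + 2 * T j.-1 * up_log 2 (n %/ T j).+1 + up_log 2 n.

Lemma size_bucket_msg j x h : size (bucket_msg j x h) <= msg_bound j.
Proof.
have size_s r : size (reply j (residual_map j x) r).2 <= up_log 2 n.
  case: r => [s|q] /=; last exact: size_heavy_answer.
  by rewrite size_take; case: ltnP => // /ltnW.
have card_g r : #|[set a | (reply j (residual_map j x) r).1 a]| <= 2 * T j.-1.
  case: r => [s|q] /=.
    by rewrite eq_card0 // => a; rewrite !inE ffunE.
  apply: leq_trans (card_light (residual_map j x) q (T_gt0 j.-1)).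
  apply/subset_leq_card/fintype.subsetP => a; rewrite inE ffunE.
  by case: ifP.
rewrite /bucket_msg; move: (size_s (received j x h)) (card_g (received j x h)).
case: (reply _ _ _) => g s /= le_s le_g; case: ifP => _; last first.
  by apply: leq_trans le_s _; rewrite leq_addl.
by rewrite size_cat size_code leq_add // leq_add2l leq_mul2r le_g orbT.
Qed.

Lemma cost_bucket_protocol : cost bucket_protocol <= \sum_(1 <= j < k.+1) msg_bound j.
Proof.
apply/bigmax_leqP => x _; rewrite /transcript -[foldl _ _ _]/(history k x).
suff le_bound i : sumn [seq size m | m <- history i x] <= \sum_(1 <= j < i.+1) msg_bound j.
  exact: le_bound.
elim: i => [|i IHi]; first by rewrite big_geq.
rewrite historyS map_rcons sumn_rcons big_nat_recr //= leq_add //.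
exact: size_bucket_msg.
Qed.

End Protocol.

(** * Choice of thresholds by iterated integer logarithms *)

Lemma up_log2_leq m : up_log 2 m <= m.
Proof. exact/up_log_min/ltnW/ltn_expl. Qed.

Lemma up_log2S_leq m : up_log 2 m.+1 <= (up_log 2 m).+1.
Proof.
apply: up_log_min => //; rewrite expnS mul2n -addnn -addn1.
by rewrite leq_add ?expn_gt0 // up_logP.
Qed.

Lemma iter_up_log2_leq s m : iter s (up_log 2) m <= m.
Proof. by elim: s => //= s IHs; apply: leq_trans (up_log2_leq _) _. Qed.

Section Widths.
Variables n k : nat.

(* Player [j] splits the answers into about [width j] buckets.  For [1 < j]
   only O(n / width j.-1) letters of log (width j), about [width j.-1], bits
   are then needed, which is O(n) in total; player 1 sends [n] letters of
   log (width 1), about log^(k-1) n, bits. *)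
Definition width j := if j == 0 then 1 else (iter (k.-1 - j) (up_log 2) n).+1.
(** The successor ensures [n < width j * threshold j], so there are at most [width j] buckets. *)
Definition threshold j := (n %/ width j).+1.

Lemma width_gt0 j : 0 < width j.
Proof. by rewrite /width; case: eqP. Qed.

Lemma width_leq j : width j <= n.+1.
Proof. by rewrite /width; case: eqP => // _; rewrite ltnS iter_up_log2_leq. Qed.

Lemma threshold0 : threshold 0 = n.+1.
Proof. by rewrite /threshold /width divn1. Qed.

Lemma threshold_last : 1 < k -> threshold k.-1 = 1.
Proof. by move=> k_gt1; rewrite /threshold /width subnn ifF ?divn_small //; lia. Qed.

Lemma up_log2_letters j : up_log 2 (n %/ threshold j).+1 <= up_log 2 (width j).
Proof. by apply/leq_up_log; rewrite ltn_divLR // mulnC ltn_ceil ?width_gt0. Qed.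

Lemma up_log2_width j : 0 < j -> up_log 2 (width j.+1) <= width j.
Proof.
rewrite /width /=; case: j => // j _ /=; have [lt_jk|le_kj] := ltnP j.+1 k.-1.
  by rewrite -[k.-1 - j.+1](@subnSK) // up_log2S_leq.
(* From index [k.-1] on, truncated subtraction makes both iteration counts 0. *)
rewrite (eqP (_ : k.-1 - j.+1 == 0)) ?subn_eq0 // (eqP (_ : k.-1 - j.+2 == 0)).
  exact: up_log2_leq.
by rewrite subn_eq0 ltnW.
Qed.

Lemma msg_bound_leq j : 1 < k -> 0 < j ->
  msg_bound n threshold j <= 6 * (n.+1 * (iter k.-1 (up_log 2) n).+1).
Proof.
move=> k_gt1; case: j => // j _; rewrite /msg_bound /=.
set u := iter _ _ _; have := up_log2_leq n; have := up_log2_letters j.+1.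
case: j => [|j].
  rewrite threshold0; set a := up_log 2 _ => le_a le_n.
  have : a <= u.+1.
    apply: leq_trans le_a _; apply: leq_trans (up_log2S_leq _) _.
    by rewrite ltnS -iterS subn1 prednK //; lia.
  nia.
move/leq_trans/(_ (up_log2_width (ltn0Sn j))); set a := up_log 2 _ => le_a le_n.
(* Up to the factor 2, there are [n %/ w + 1] names of at most [w] bits, hence at most
   [n + w <= 2 * n + 1] bits. *)
have := leq_trunc_div n (width j.+1); have := width_leq j.+1.
rewrite {1}/threshold; set w := width _ in le_a *; nia.
Qed.

End Widths.

(** * Comparison with the real iterated logarithm *)

Section IteratedLog.
Variable R : realType.
Local Open Scope ring_scope.

Lemma ln2_gt0 : 0 < ln 2 :> R.
Proof. by rewrite ln_gt0 // ltr1n. Qed.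

Lemma ler_log2 (x y : R) : 0 < x -> x <= y -> log2 x <= log2 y.
Proof.
move=> x_gt0 le_xy; rewrite /log2 ler_pM2r ?invr_gt0 ?ln2_gt0 //.
by rewrite ler_ln // posrE // (lt_le_trans x_gt0).
Qed.

Lemma log2M (x y : R) : 0 < x -> 0 < y -> log2 (x * y) = log2 x + log2 y.
Proof. by move=> x0 y0; rewrite /log2 lnM ?posrE // mulrDl. Qed.

Lemma log2_pow2 m : log2 (2 ^+ m) = m%:R :> R.
Proof. by rewrite /log2 lnXn // -[ln 2 *+ m]mulr_natl mulfK // gt_eqF ?ln2_gt0. Qed.

Lemma up_log2_le_log2 m : (up_log 2 m)%:R <= Num.max 0 (log2 m%:R + 1) :> R.
Proof.
have [|m_gt1] := leqP m 1.
  by move=> m_le1; rewrite (eqP (_ : up_log 2 m == 0%N)) ?up_log_eq0 ?m_le1 // le_max lexx.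
have : ((2 ^ (up_log 2 m).-1)%:R : R) <= m%:R by rewrite ler_nat ltnW // up_log_gtn.
rewrite natrX => /(ler_log2 (exprn_gt0 _ (ltr0Sn _ _))).
rewrite log2_pow2 -(lerD2r 1) natr1 prednK ?up_log_gt0 // => le_m.
by rewrite le_max le_m orbT.
Qed.

Lemma iterlog_ge m (A : R) : exists N, forall n, (N <= n)%N -> A <= iterlog R m n.
Proof.
elim: m A => [|m IHm] A.
  exists (Num.bound `|A|) => n; rewrite -(ler_nat R); apply: le_trans.
  by rewrite ltW // (le_lt_trans (ler_norm A)) // archi_boundP.
(* The argument is 2 to the power [A], whose [log2] is [A]. *)
have [N ge_N] := IHm (expR (A * ln 2)); exists N => n /ge_N le_exp.
apply: le_trans (ler_log2 (expR_gt0 _) le_exp).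
by rewrite /log2 expRK mulfK // gt_eqF ?ln2_gt0.
Qed.

(** At each step rounding adds at most 1 and the old constant adds [log2 C]; once the next iterated
    logarithm is at least 1, both are absorbed into the new constant. *)
Lemma iter_up_log2_le_iterlog m : exists2 C : R, 0 < C &
  exists N, forall n, (N <= n)%N -> (iter m (up_log 2) n)%:R <= C * iterlog R m n.
Proof.
elim: m => [|m [C C_gt0 [N le_N]]].
  by exists 1 => //; exists 0%N => n _; rewrite mul1r.
have [N1 ge1] := iterlog_ge m.+1 1; have [N0 ge0] := iterlog_ge m 1.
exists (`|log2 C| + 2); first by rewrite ltr_wpDl.
exists (maxn N (maxn N0 N1)) => n; rewrite !geq_max => /and3P[/le_N le_u /ge0 l0 /ge1 l1].
have l_gt0 : 0 < iterlog R m n by apply: lt_le_trans l0.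
have c_le := ler_norm (log2 C); have c_ge := normr_ge0 (log2 C).
move: l1 le_u; rewrite iterS -[iterlog R m.+1 n]/(log2 (iterlog R m n)).
set u := iter m _ n; set l := iterlog R m n; move=> l1 le_u.
apply: le_trans (up_log2_le_log2 u) _.
rewrite ge_max; apply/andP; split; first by rewrite mulr_ge0 ?addr_ge0 // (le_trans _ l1).
have [->|u_gt0] := posnP u; first by rewrite /log2 ln0 // mul0r add0r -/(log2 l); nra.
have := ler_log2 _ le_u; rewrite ltr0n => /(_ u_gt0).
by rewrite log2M //; nra.
Qed.

End IteratedLog.

Theorem theorem4p2 (R : realType) (k j0 : nat) (hk : 2 <= k)
    (hj0 : 2 <= j0 <= k) :
  has_collapsing_protocols R (fun n : nat => @perm_except n k j0) /\
  has_collapsing_protocols R (fun n : nat => @all_perm n k).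
Proof.
suff [P [coll comp cost_P]] :
    has_collapsing_protocols R (fun n : nat => @perm_except n k j0).
  split; exists P; split=> // n x x_perm; apply: comp => t _; exact: x_perm.
have j0_gt0 : 0 < j0 by lia.
have T0 n := threshold0 n k; have Tlast n := threshold_last n hk.
exists (fun n => bucket_protocol n k j0 (threshold n k)); split=> [n|n|].
- exact: bucket_protocol_collapsing.
- exact: bucket_protocol_computes.
apply/eqO_exP.
have [C C_gt0 [N le_N]] := iter_up_log2_le_iterlog R k.-1.
have [N1 ge1] := iterlog_ge k.-1 (1 : R).
(* There are [k] messages; [6 * n.+1 <= 12 * n] for positive [n], and [C + 1] absorbs the successor
   once the iterated logarithm is at least 1. *)
exists ((12 * k)%:R * (C + 1))%R.
  by rewrite mulr_gt0 ?addr_gt0 // ltr0n; lia.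
near=> n.
have n_gt0 : 0 < n by near: n; exact: nbhs_infty_ge.
have l1 : (1 <= iterlog R k.-1 n)%R by apply: ge1; near: n; exact: nbhs_infty_ge.
have le_u : ((iter k.-1 (up_log 2) n)%:R <= C * iterlog R k.-1 n)%R.
  by apply: le_N; near: n; exact: nbhs_infty_ge.
rewrite normr_nat ger0_norm; last by rewrite mulr_ge0 // (le_trans _ l1).
have : cost (bucket_protocol n k j0 (threshold n k)) <=
    12 * k * (n * (iter k.-1 (up_log 2) n).+1).
  apply: leq_trans (cost_bucket_protocol _ _ _ _) _ => //.
  apply: leq_trans (_ : \sum_(1 <= j < k.+1) 12 * (n * (iter k.-1 (up_log 2) n).+1) <= _).
    rewrite big_nat [leqRHS]big_nat; apply: leq_sum => j /andP[j_gt0 _].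
    by apply: leq_trans (msg_bound_leq n hk j_gt0) _; nia.
  by rewrite sum_nat_const_nat subSS subn0; lia.
rewrite -(ler_nat R) => /le_trans; apply.
rewrite natrM -mulrA ler_wpM2l // natrM mulrCA ler_wpM2l // -natr1; nra.
Unshelve. all: by end_near.
Qed.
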